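(* For an infinite set $A$, the set $A^A$ of functions $A\to A$, together with the partial map $(\alpha,\beta)\mapsto\alpha\beta$ defined by interrogations (see context), has the structure of a partial combinatory algebra.
   Context: Partial combinatory algebra: a set $X$ with a partial function $X\times X\rightharpoonup X$, written $x,y\mapsto xy$, such that there exist $k,s\in X$ satisfying: $(k)$ for any $x,y\in X$, $kx$ and $(kx)y$ are defined, and $(kx)y=x$; $(s)$ for any $x,y,z\in X$, $sx$ and $(sx)y$ are defined, and $((sx)y)z$ is defined precisely if $(xz)(yz)$ is, and these expressions define the same element of $X$ if defined. The partial map on $A^A$. Fix an injective coding $A^*\to A$, $(a_0,\ldots,a_{n-1})\mapsto\langle a_0,\ldots,a_{n-1}\rangle$, of finite sequences of elements of $A$, and two distinct elements $q,r\in A$. For $\alpha,\beta\in A^A$ and $a\in A$, $u=\langle a_0,\ldots,a_{n-1}\rangle$ is an $a$-interrogation of $\beta$ by $\alpha$ if for each $j\le n-1$ there is $b\in A$ with $\alpha(\langle a,a_0,\ldots,a_{j-1}\rangle)=\langle q,b\rangle$ and $\beta(b)=a_j$. $\varphi^a(\alpha,\beta)$ is defined with value $c$ if for some $a$-interrogation $\langle a_0,\ldots,a_{n-1}\rangle$ of $\beta$ by $\alpha$, $\alpha(\langle a,a_0,\ldots,a_{n-1}\rangle)=\langle r,c\rangle$. $\alpha\beta$ is defined if and only if $\varphi^a(\alpha,\beta)$ is defined for every $a\in A$, and then $\alpha\beta\in A^A$ is the function $a\mapsto\varphi^a(\alpha,\beta)$. *)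

(* Defs.v *)
From mathcomp Require Import all_boot.
From mathcomp Require Import boolp classical_sets functions cardinality.

Set Implicit Arguments.
Unset Strict Implicit.
Unset Printing Implicit Defensive.

(* A partial function X * X -> X is given by its graph: [app x y z] reads
   "xy is defined and equal to z"; [functional_graph] says that the graph is
   single-valued. *)
Definition functional_graph (X : Type) (app : X -> X -> X -> Prop) : Prop :=
  forall x y z z', app x y z -> app x y z' -> z = z'.

Definition k_axiom (X : Type) (app : X -> X -> X -> Prop) (k : X) : Prop :=
  forall x y, exists2 kx, app k x kx & app kx y x.

(* For a functional graph the final equivalence is Kleene equality:
   ((sx)y)z is defined iff (xz)(yz) is, with the same value; (xz)(yz) being
   defined requires both xz and yz to be defined. *)
Definition s_axiom (X : Type) (app : X -> X -> X -> Prop) (s : X) : Prop :=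
  forall x y z, exists sx sxy,
    [/\ app s x sx, app sx y sxy
      & forall w, app sxy z w <->
          exists xz yz, [/\ app x z xz, app y z yz & app xz yz w]].

Definition is_pca (X : Type) (app : X -> X -> X -> Prop) : Prop :=
  functional_graph app /\ exists k s, k_axiom app k /\ s_axiom app s.

(* [code [:: a_0; ...; a_(n-1)]] is <a_0, ..., a_(n-1)>. The default value of
   [nth] is never used, since j < size u. *)
Definition interrogation (A : Type) (code : seq A -> A) (q : A)
    (a : A) (alpha beta : A -> A) (u : seq A) : Prop :=
  forall j : nat, j < size u ->
    exists b : A, alpha (code (a :: take j u)) = code [:: q; b]
               /\ beta b = nth a u j.

(* "phi^a(alpha, beta) is defined with value c" *)
Definition phi (A : Type) (code : seq A -> A) (q r : A)
    (a : A) (alpha beta : A -> A) (c : A) : Prop :=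
  exists u : seq A, interrogation code q a alpha beta u
                 /\ alpha (code (a :: u)) = code [:: r; c].

(* "alpha beta is defined with value gamma" *)
Definition interrogation_app (A : Type) (code : seq A -> A) (q r : A)
    (alpha beta gamma : A -> A) : Prop :=
  forall a : A, phi code q r a alpha beta (gamma a).

Lemma interrogation_app_definedP (A : Type) (code : seq A -> A) (q r : A)
    (alpha beta : A -> A) :
  (exists gamma, interrogation_app code q r alpha beta gamma) <->
  (forall a, exists c, phi code q r a alpha beta c).
Proof.
split=> [[gamma h] a|h]; first by exists (gamma a).
by have [gamma hgamma] := choice h; exists gamma.
Qed.

(* Main.v *)
Require Import Defs.
From mathcomp Require Import all_boot.
From mathcomp Require Import boolp classical_sets functions cardinality.

(** An interrogation of [beta] by [alpha] at [a] is a deterministic run: the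
    state is the list of answers received so far, and the value of [alpha]
    there says whether to query [beta], to stop with a value, or to be stuck.
    So application is single-valued ([phi_inj]).  Conversely every transition
    system over [A], whatever its set of states, is the behaviour of some
    element of [A -> A]: its value at [<a, u>] is what the system does after
    receiving the answers [u] ([phi_program]).  Thus combinators can be built
    as machines.

    If [F alpha beta a] is computed by a well-founded decision tree reading
    finitely many values of [alpha] and [beta], then some [f] satisfies
    [(f alpha) beta = F alpha beta] for all [alpha, beta], with [f alpha]
    total ([tree_representable]).  The value of [f alpha] at [<a, v>] follows
    the tree at [a], reading [alpha] freely and taking the values of [beta]
    from [v]; computing that value is again a matter of finitely many queries
    to [alpha].  The combinator k is the tree that reads [alpha] at [a].

    For s, the element [s alpha beta] must interrogate [gamma] so as to
    compute [(alpha gamma)(beta gamma)]; this is a machine simulating the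
    nested interrogations ([subst_step]).  Two points need care.  First,
    [s alpha beta] has to be total although the simulation may diverge: after
    each value of [alpha] or [beta] that it reads, the machine either stops,
    is stuck, or queries [gamma], if need be with a query whose answer is
    ignored.  Hence its action after the answers [u] depends on at most
    [size u + 1] values of [alpha] and [beta], and is given by a finite tree.
    Second, [(alpha gamma)(beta gamma)] is defined only when [alpha gamma] and
    [beta gamma] are total, whereas the simulation visits some of their
    arguments only.  So at [a] the machine begins by computing
    [(alpha gamma) a] and [(beta gamma) a] and discards the results; letting
    [a] vary, both are then total whenever [s alpha beta] applies to [gamma]
    ([sim_startE]). *)

Set Implicit Arguments.
Unset Strict Implicit.
Unset Printing Implicit Defensive.

(** * Transition systems querying an oracle *)

Inductive outcome (A S : Type) : Type :=
  | Done of A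
  | Ask of A & (A -> S)
  | Stuck.
Arguments Done {A S}.
Arguments Ask {A S}.
Arguments Stuck {A S}.

Section Machines.
Variables (A S : Type) (step : S -> outcome A S) (beta : A -> A).

Inductive run : S -> A -> Prop :=
  | run_done s c of step s = Done c : run s c
  | run_ask s b next c of step s = Ask b next & run (next (beta b)) c : run s c.

Definition run_outcome (o : outcome A S) (c : A) : Prop :=
  match o with
  | Done c' => c' = c
  | Ask b next => run (next (beta b)) c
  | Stuck => False
  end.

Lemma runE s c : run s c <-> run_outcome (step s) c.
Proof.
split=> [[{}s {}c -> //|{}s b next {}c -> //]|].
case Es: (step s) => [c'|b next|] //=; last exact: run_ask Es.
by move=> <-; exact: run_done.
Qed.

Lemma run_inj s c c' : run s c -> run s c' -> c = c'.
Proof.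
by elim=> [{}s {}c Es|{}s b next {}c Es _ IH] /runE; rewrite Es.
Qed.

End Machines.

(** * Interrogations as runs *)

Section Dialogues.
Variables (A : Type) (code : seq A -> A) (code_inj : injective code).
Variables (q r : A) (q_neq_r : q <> r).

Definition decode (x : A) : option (seq A) :=
  if pselect (exists l, code l = x) is left h then Some (sval (cid h))
  else None.

Lemma codeK : pcancel code decode.
Proof.
move=> l; rewrite /decode; case: pselect => [h|[]]; last by exists l.
by congr Some; apply: code_inj; exact: svalP (cid h).
Qed.

Lemma decode_some x l : decode x = Some l -> x = code l.
Proof.
by rewrite /decode; case: pselect => // h [<-]; rewrite (svalP (cid h)).
Qed.

(** Being stuck is coded by a value of neither form of reply; by injectivity of
    the coding, the code of the empty sequence is one. *)
Definition say (S : Type) (o : outcome A S) : A :=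
  match o with
  | Done c => code [:: r; c]
  | Ask b _ => code [:: q; b]
  | Stuck => code [::]
  end.

(** The continuation [next] is what an interrogator does with the answer,
    should [v] turn out to be a query. *)
Definition hear (S : Type) (next : A -> S) (v : A) : outcome A S :=
  if decode v is Some [:: t; b] then
    if `[< t = q >] then Ask b next else if `[< t = r >] then Done b else Stuck
  else Stuck.

Lemma hear_say (S T : Type) (next : A -> S) (o : outcome A T) :
  hear next (say o) =
  match o with Done c => Done c | Ask b _ => Ask b next | Stuck => Stuck end.
Proof.
case: o => [c|b next'|]; rewrite /hear /= codeK //.
  by rewrite asboolF ?asboolT // => /esym.
by rewrite asboolT.
Qed.

Lemma hear_query (S : Type) (next : A -> S) b :
  hear next (code [:: q; b]) = Ask b next.
Proof. exact: (hear_say next (Ask b next)). Qed.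

Lemma hear_answer (S : Type) (next : A -> S) c :
  hear next (code [:: r; c]) = Done c.
Proof. exact: (hear_say next (@Done A S c)). Qed.

Variant hear_spec (S : Type) (next : A -> S) (v : A) : outcome A S -> Type :=
  | HearAnswer c of v = code [:: r; c] : hear_spec next v (Done c)
  | HearQuery b of v = code [:: q; b] : hear_spec next v (Ask b next)
  | HearNothing : hear_spec next v Stuck.

Lemma hearP (S : Type) (next : A -> S) v : hear_spec next v (hear next v).
Proof.
rewrite /hear; case Ev: (decode v) => [[|t [|b []]]|]; try exact: HearNothing.
move/decode_some: Ev => Ev; case: asboolP => [Et|_].
  by apply: HearQuery; rewrite Ev Et.
case: asboolP => [Et|_]; last exact: HearNothing.
by apply: HearAnswer; rewrite Ev Et.
Qed.

Definition interrogator (alpha : A -> A) (a : A) (u : seq A) :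
    outcome A (seq A) :=
  hear (rcons u) (alpha (code (a :: u))).

(** An interrogation resumed after the answers [w]; this generality is what
    inductions on the remaining answers need. *)
Definition dialogue a (alpha beta : A -> A) (w u : seq A) (c : A) : Prop :=
  (forall j, j < size u -> exists b,
     alpha (code (a :: w ++ take j u)) = code [:: q; b] /\ beta b = nth a u j)
  /\ alpha (code (a :: w ++ u)) = code [:: r; c].

Lemma dialogue_run a alpha beta w c :
  (exists u, dialogue a alpha beta w u c) <->
  run (interrogator alpha a) beta w c.
Proof.
split=> [[u]|].
  elim: u w => [|d u IH] w [hu hc].
    by apply: run_done; rewrite /interrogator -[w]cats0 hc hear_answer.
  have [//|b []] := hu 0; rewrite take0 cats0 /= => hb hd.
  apply: (@run_ask _ _ _ _ _ b (rcons w)).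
    by rewrite /interrogator hb hear_query.
  apply: IH; rewrite hd /dialogue cat_rcons; split=> // j ltj.
  by rewrite cat_rcons; exact: (hu j.+1).
elim=> [{}w {}c|{}w b next {}c + _]; rewrite /interrogator.
  by case: hearP => // c1 hc [<-]; exists [::]; split=> //; rewrite cats0.
case: hearP => // b1 hb [Eb En]; subst b1 next => -[u [hu hc]].
exists (beta b :: u).
split; last by rewrite -cat_rcons.
case=> [_|j ltj]; first by rewrite take0 cats0; exists b.
by rewrite /= -cat_rcons; exact: hu.
Qed.

Lemma phi_run a alpha beta c :
  phi code q r a alpha beta c <-> run (interrogator alpha a) beta [::] c.
Proof. exact: (dialogue_run a alpha beta [::]). Qed.

Lemma phi_inj a alpha beta c c' :
  phi code q r a alpha beta c -> phi code q r a alpha beta c' -> c = c'.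
Proof. by move=> /phi_run h /phi_run; exact: run_inj h. Qed.

Lemma interrogation_app_inj : functional_graph (interrogation_app code q r).
Proof.
move=> alpha beta gamma gamma' h h'; apply: funext => a.
exact: phi_inj (h a) (h' a).
Qed.

(** * Every transition system is an element of [A -> A] *)

Section Programs.
Variables (S : Type) (step : S -> outcome A S).

(** A system that has halted repeats its last action. *)
Fixpoint follow (s : S) (u : seq A) : A :=
  match u, step s with
  | d :: u', Ask _ next => follow (next d) u'
  | _, o => say o
  end.

Variable init : A -> S.

Definition program (x : A) : A :=
  if decode x is Some (a :: u) then follow (init a) u else code [:: r; x].

(** The interrogation with answers [w] and the system in state [s] are kept in
    step by the invariant that the program at [<a, w ++ u>] follows [s] along
    [u]; each side determines the next action of the other. *)
Lemma phi_program a beta c :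
  phi code q r a program beta c <-> run step beta (init a) c.
Proof.
apply: (iff_trans (phi_run _ _ _ _)).
have: forall u, program (code (a :: [::] ++ u)) = follow (init a) u.
  by move=> u; rewrite /program codeK.
move: (init a) [::] => s w prog; split.
  move=> hw; elim: hw s prog => [{}w {}c + s prog|{}w b next {}c + _ IH s prog];
    have := prog [::]; rewrite cats0 /interrogator => -> /=; rewrite hear_say.
    by move=> Es; apply: run_done; case: (step s) Es => // c' [->].
  case Es: (step s) => [//|b' next'|//] [Eb En]; subst b' next.
  apply: (run_ask Es); apply: IH => u.
  by rewrite cat_rcons prog /= Es.
move=> hs; elim: hs w prog => [{}s {}c Es|{}s b next {}c Es _ IH] w prog;
  have := prog [::]; rewrite cats0 /= Es /= => prog0.
  by apply: run_done; rewrite /interrogator prog0 hear_answer.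
apply: (@run_ask _ _ _ _ _ b (rcons w)).
  by rewrite /interrogator prog0 hear_query.
by apply: IH => u; rewrite cat_rcons prog /= Es.
Qed.

End Programs.

(** * Total functionals of two arguments *)

Variant side := Left | Right.

Definition pick (sd : side) (alpha beta : A -> A) : A -> A :=
  if sd is Left then alpha else beta.

Inductive tree : Type :=
  | Return of A
  | Read of side & A & (A -> tree).

Fixpoint eval (alpha beta : A -> A) (t : tree) : A :=
  match t with
  | Return c => c
  | Read sd x k => eval alpha beta (k (pick sd alpha beta x))
  end.

(** The interrogation of the second oracle when the first one is known. *)
Fixpoint known_left (alpha : A -> A) (t : tree) : outcome A tree :=
  match t with
  | Return c => Done c
  | Read Left x k => known_left alpha (k (alpha x))
  | Read Right x k => Ask x k
  end.

(** The interrogation of the first oracle, to find out what [known_left] does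
    after the answers [v] of the second one; the codes returned are those of
    its action. *)
Fixpoint known_right (t : tree) (v : seq A) : outcome A (tree * seq A) :=
  match t with
  | Return c => Done (code [:: r; c])
  | Read Left x k => Ask x (fun d => (k d, v))
  | Read Right x k => if v is d :: v' then known_right (k d) v'
                      else Done (code [:: q; x])
  end.

Lemma run_known_left alpha beta t :
  run (known_left alpha) beta t (eval alpha beta t).
Proof.
elim: t => [c|[] x k IH] /=; first exact: run_done.
- by move/runE: (IH (alpha x)) => ?; apply/runE.
- by apply: run_ask (IH (beta x)).
Qed.

Lemma run_known_right alpha t v :
  run (fun s => known_right s.1 s.2) alpha (t, v)
    (follow (known_left alpha) t v).
Proof.
elim: t v => [c|[] x k IH] v.
- by apply: run_done; case: v.
- apply: run_ask => //=.
  have -> : follow (known_left alpha) (Read Left x k) v =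
            follow (known_left alpha) (k (alpha x)) v by case: v.
  exact: IH.
- case: v => [|d v]; first exact: run_done.
  by apply/runE => /=; move/runE: (IH d v).
Qed.

(** The first interrogation computes, value by value, the program of the
    second one, which depends on [alpha] only through finitely many values at
    each argument. *)
Lemma tree_representable (t : A -> tree) : exists f, forall alpha beta,
  exists2 f_alpha, interrogation_app code q r f alpha f_alpha &
    interrogation_app code q r f_alpha beta (fun a => eval alpha beta (t a)).
Proof.
exists (program (fun s => known_right s.1 s.2) (fun y =>
  (* Off the codes of nonempty sequences, [program] takes the value
     [code [:: r; y]], which is also what [known_right] returns here. *)
  if decode y is Some (x :: v) then (t x, v) else (Return y, [::]))).
move=> alpha beta; exists (program (known_left alpha) t) => [y|a]; last first.
  by apply/phi_program; exact: run_known_left.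
apply/phi_program; rewrite /program.
case: decode => [[|x v]|]; try exact: run_done.
exact: run_known_right.
Qed.

Lemma k_exists : exists k, k_axiom (interrogation_app code q r) k.
Proof.
have [k hk] := tree_representable (fun a => Read Left a Return).
by exists k => alpha beta; exact: hk.
Qed.

(** * The combinator s *)

(** What to do with the value of a simulated call.  The first two tasks are the
    totality checks at [a], whose values are discarded.  [ThenObey a h] awaits
    [(alpha gamma) <a, h>], the next action in the outer interrogation at [a]
    after the answers [h]; [ThenRecord a h] awaits the answer of [beta gamma]
    to the query thus made. *)
Inductive task : Type :=
  | ThenCheckR of A
  | ThenStart of A
  | ThenObey of A & seq A
  | ThenRecord of A & seq A.

(** [Call sd x w k] is the computation of the value at [x] of [alpha gamma] or
    [beta gamma], according to [sd], after the answers [w] of [gamma]; its value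
    is handed to [k]. *)
Inductive state : Type :=
  | Call of side & A & seq A & task.

Definition start (a : A) : state := Call Left a [::] (ThenCheckR a).

(** A call that ends is always followed by a query to [gamma], unless the whole
    computation ends.  Where no answer is wanted the query is [c], chosen only
    because it is at hand. *)
Definition resume (k : task) (c : A) : outcome A state :=
  match k with
  | ThenCheckR a => Ask c (fun _ => Call Right a [::] (ThenStart a))
  | ThenStart a =>
      Ask c (fun _ => Call Left (code [:: a]) [::] (ThenObey a [::]))
  | ThenObey a h =>
      match hear id c with
      | Done e => Done e
      | Ask b _ => Ask c (fun _ => Call Right b [::] (ThenRecord a h))
      | Stuck => Stuck
      end
  | ThenRecord a h =>
      let h' := rcons h c in
      Ask c (fun _ => Call Left (code (a :: h')) [::] (ThenObey a h'))
  end.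

Definition react (s : state) (v : A) : outcome A state :=
  let: Call sd x w k := s in
  match hear (fun d => Call sd x (rcons w d) k) v with
  | Done c => resume k c
  | o => o
  end.

Definition reading (s : state) : side * A :=
  let: Call sd x w k := s in (sd, code (x :: w)).

Definition subst_step (alpha beta : A -> A) (s : state) : outcome A state :=
  react s (pick (reading s).1 alpha beta (reading s).2).

(** Recursion on the answers [u] is possible because every step that does not
    halt consumes one of them; this is where the idle queries matter. *)
Fixpoint state_tree (s : state) (u : seq A) : tree :=
  Read (reading s).1 (reading s).2 (fun v =>
    match u, react s v with
    | d :: u', Ask _ next => state_tree (next d) u'
    | _, o => Return (say o)
    end).

Lemma eval_state_tree alpha beta s u :
  eval alpha beta (state_tree s u) = follow (subst_step alpha beta) s u.
Proof.
by elim: u s => [|d u IH] s //=; rewrite -/(subst_step _ _ _); case: subst_step.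
Qed.

Definition subst_tree (y : A) : tree :=
  if decode y is Some (a :: u) then state_tree (start a) u
  else Return (code [:: r; y]).

Lemma eval_subst_tree alpha beta :
  (fun y => eval alpha beta (subst_tree y)) =
  program (subst_step alpha beta) start.
Proof.
apply: funext => y; rewrite /subst_tree /program.
by case: decode => [[|a u]|] //; exact: eval_state_tree.
Qed.

Section Substitution.
Variables alpha beta gamma : A -> A.
Local Notation sim := (run (subst_step alpha beta) gamma).

(** A call runs exactly as the interrogation it simulates, until the latter has
    a value and the task takes over. *)
Lemma sim_call sd x w k e :
  sim (Call sd x w k) e <->
  exists2 c, run (interrogator (pick sd alpha beta) x) gamma w c
           & run_outcome (subst_step alpha beta) gamma (resume k c) e.
Proof.
split.
  move=> hs; move Es: (Call sd x w k) hs => s hs.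
  elim: hs w Es => [{}s {}e + w Es|{}s b next {}e + hn IH w Es];
    rewrite -{}Es /subst_step /=; case: hearP => [c hc hk|b' hb //|//].
  - exists c; last by rewrite hk.
    by apply: run_done; rewrite /interrogator hc hear_answer.
  - exists c; last by rewrite hk.
    by apply: run_done; rewrite /interrogator hc hear_answer.
  - move=> [Eb En]; subst b' next.
    have [c hc hk] := IH _ erefl; exists c => //.
    by apply: run_ask hc; rewrite /interrogator hb hear_query.
move=> [c hc]; elim: hc => [{}w {}c|{}w b next {}c + _ IH];
  rewrite /interrogator; case: hearP => // v hv.
- move=> [Ev] hk; subst v.
  by apply/runE; rewrite /subst_step /= hv hear_answer.
- move=> [Eb En] hk; subst v next.
  by apply/runE; rewrite /subst_step /= hv hear_query; exact: IH.
Qed.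

Lemma sim_startE a e :
  sim (start a) e <->
  [/\ exists c, phi code q r a alpha gamma c,
      exists c, phi code q r a beta gamma c
    & sim (Call Left (code [:: a]) [::] (ThenObey a [::])) e].
Proof.
split=> [/sim_call [c hc /sim_call [d hd he]]|[[c hc] [d hd] he]].
  by split=> //; [exists c | exists d]; apply/phi_run.
apply/sim_call; exists c; first exact/phi_run.
by apply/sim_call; exists d; first exact/phi_run.
Qed.

Variables xz yz : A -> A.
Hypothesis xzP : interrogation_app code q r alpha gamma xz.
Hypothesis yzP : interrogation_app code q r beta gamma yz.

(** One step of the outer interrogation unfolds into a call to [alpha], and, if
    a query results, a call to [beta]. *)
Lemma interrogation_sim a h e :
  run (interrogator xz a) yz h e ->
  sim (Call Left (code (a :: h)) [::] (ThenObey a h)) e.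
Proof.
elim=> [{}h {}e|{}h b next {}e + _ IH]; rewrite /interrogator;
  case: hearP => // v hv.
- move=> [Ev]; subst v; apply/sim_call; exists (xz (code (a :: h))).
    by apply/phi_run; exact: xzP.
  by rewrite hv /= hear_answer.
- move=> [Eb En]; subst v next; apply/sim_call; exists (xz (code (a :: h))).
    by apply/phi_run; exact: xzP.
  rewrite hv /= hear_query; apply/sim_call; exists (yz b) => //.
  by apply/phi_run; exact: yzP.
Qed.

(** What a terminating simulation, ending in [e], guarantees about the outer
    interrogation when a pending task receives [c].  During the two checks it has
    not begun yet. *)
Definition promise (k : task) (c e : A) : Prop :=
  match k with
  | ThenCheckR _ | ThenStart _ => True
  | ThenObey a h => run_outcome (interrogator xz a) yz (hear (rcons h) c) e
  | ThenRecord a h => run (interrogator xz a) yz (rcons h c) e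
  end.

(** The induction is on the whole simulation, so the states in the middle of a
    call have to be covered; [promise] is the invariant that does it. *)
Lemma sim_promise sd x w k e : sim (Call sd x w k) e ->
  forall c, run (interrogator (pick sd alpha beta) x) gamma w c ->
  promise k c e.
Proof.
move=> hs; move Es: (Call sd x w k) hs => s hs.
elim: hs sd x w k Es =>
    [{}s {}e + sd x w k Es|{}s b next {}e + _ IH sd x w k Es] c;
  rewrite -{}Es /subst_step /= => + /runE; rewrite /interrogator;
  case: hearP => //= v ->; rewrite ?hear_answer ?hear_query /=.
- move=> + <-; case: k => //= a h; case: hearP => // e' -> [->].
  by rewrite hear_answer.
- move=> + <-; case: k => //= a h.
    case: hearP => // b' -> [_ En]; subst next; rewrite hear_query /=.
    by apply: (IH _ _ _ _ erefl); apply/phi_run; exact: yzP.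
  move=> [_ En]; subst next; apply/runE.
  by apply: (IH _ _ _ _ erefl); apply/phi_run; exact: xzP.
- by move=> [-> En]; subst next; exact: (IH _ _ _ _ erefl).
Qed.

(** The converse of [interrogation_sim] comes from the promise of the first
    outer call, whose value is [xz <a>]. *)
Lemma sim_interrogation a e :
  sim (Call Left (code [:: a]) [::] (ThenObey a [::])) e <->
  phi code q r a xz yz e.
Proof.
split=> [hs|/phi_run]; last exact: interrogation_sim.
apply/phi_run/runE; apply: (sim_promise hs).
by apply/phi_run; exact: xzP.
Qed.

End Substitution.

Lemma s_exists : exists s, s_axiom (interrogation_app code q r) s.
Proof.
have [s hs] := tree_representable subst_tree.
exists s => alpha beta gamma; have [sx hsx hsxy] := hs alpha beta.
exists sx, (fun y => eval alpha beta (subst_tree y)); split=> // w.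
rewrite eval_subst_tree; split=> [hw|[xz [yz [hxz hyz hw]]] a].
  have {}hw a :=
    iffLR (sim_startE _ _ _ _ _) (iffLR (phi_program _ _ _ _ _) (hw a)).
  have [|xz hxz] := iffRL (interrogation_app_definedP code q r alpha gamma).
    by move=> a; have [] := hw a.
  have [|yz hyz] := iffRL (interrogation_app_definedP code q r beta gamma).
    by move=> a; have [] := hw a.
  exists xz, yz; split=> // a; apply/(sim_interrogation hxz hyz).
  by have [] := hw a.
apply/phi_program/sim_startE; split; first by exists (xz a).
  by exists (yz a).
by apply/(sim_interrogation hxz hyz); exact: hw.
Qed.

End Dialogues.

Theorem theorem2p7 (A : Type) (A_infinite : infinite_set [set: A]%classic)
    (code : seq A -> A) (code_inj : injective code)
    (q r : A) (q_neq_r : q <> r) :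
  is_pca (interrogation_app code q r).
Proof.
split; first exact: interrogation_app_inj.
have [k hk] := k_exists code_inj q_neq_r.
have [s hs] := s_exists code_inj q_neq_r.
by exists k, s.
Qed.
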